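(* Let $m,n$ be positive integers, let $(d(k))_{k\in\mathbb{Z}}$ be complex numbers (e.g. the Fourier coefficients of $f\in L^1(\mathbb{T})$, $f(z)=\sum_k d(k)z^k$), and let $R$ be a non-negative integer such that $D^{[2m]}_n(f)=D^{[2m]}_n(F_R)$, where $F_R(z)=\sum_{k\ge -R}d(k)z^k$ (e.g. any $R\ge m(n-1)$). Let $\gamma(f,n,m,R)$ be the coefficient of $Q^{(1/m)}_{(R^n)}(\mathbf{x}_1,\dots,\mathbf{x}_n)$ in the expansion of the formal power series $$S_f(\mathbf{x}_1,\dots,\mathbf{x}_n;R)=\prod_{k=1}^n\mathbf{x}_k^RF_R(\mathbf{x}_k)\in\mathbb{C}[[\mathbf{x}_1,\dots,\mathbf{x}_n]]$$ in terms of the Jack $Q$-polynomials $Q^{(1/m)}_\lambda(\mathbf{x}_1,\dots,\mathbf{x}_n)$. Then $$\widehat{D}^{[2m]}_n(f)=\gamma(f,n,m,R)\prod_{i=1}^n\prod_{j=1}^R\frac{im+j-1}{(i-1)m+j}.$$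
   Context: Toeplitz hyperdeterminant of a sequence/function with coefficients $d(k)$: $D^{[2m]}_n(f)=\mathrm{Det}^{[2m]}\big(d(i_1+\cdots+i_m-i_{m+1}-\cdots-i_{2m})\big)_{1\le i_1,\dots,i_{2m}\le n}$, where $\mathrm{Det}^{[2m]}(A):=\frac{1}{n!}\sum_{\sigma_1,\dots,\sigma_{2m}\in\mathfrak{S}_n}\prod_j\mathrm{sgn}(\sigma_j)\prod_{i=1}^nA(\sigma_1(i),\dots,\sigma_{2m}(i))$; normalized version $\widehat{D}^{[2m]}_n(f)=D^{[2m]}_n(f)/D^{[2m]}_n(\mathbf{1})$, where $\mathbf{1}$ is the constant function $1$ and $D^{[2m]}_n(\mathbf{1})=\frac{(mn)!}{n!(m!)^n}$. $(R^n)$ is the partition $(R,\dots,R)$ with $n$ parts. Jack functions (parameter $\alpha>0$): with power sums $p_k=\sum_i\mathbf{x}_i^k$, $p_\lambda=p_{\lambda_1}p_{\lambda_2}\cdots$, the scalar product $\langle p_\lambda,p_\mu\rangle_\alpha=\delta_{\lambda\mu}z_\lambda\alpha^{\ell(\lambda)}$ where $z_\lambda=\prod_{k\ge1}k^{m_k}m_k!$, $m_k=\#\{i:\lambda_i=k\}$. The Jack $P$-function $P^{(\alpha)}_\lambda$ is the unique homogeneous symmetric function of the form $m_\lambda+\sum_{\mu<\lambda}u_{\lambda\mu}m_\mu$ ($m_\mu$ monomial symmetric functions, $<$ the dominance order) with $\langle P^{(\alpha)}_\lambda,P^{(\alpha)}_\mu\rangle_\alpha=0$ for $\lambda\ne\mu$.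 With $c_\lambda(\alpha)=\prod_{(i,j)\in\lambda}(\alpha(\lambda_i-j)+\lambda'_j-i+1)$ and $c'_\lambda(\alpha)=\prod_{(i,j)\in\lambda}(\alpha(\lambda_i-j+1)+\lambda'_j-i)$ ($\lambda'$ the conjugate partition), $Q^{(\alpha)}_\lambda=c_\lambda(\alpha)c'_\lambda(\alpha)^{-1}P^{(\alpha)}_\lambda$. Jack polynomials are their specializations to finitely many variables; each homogeneous component of a symmetric formal power series in $\mathbf{x}_1,\dots,\mathbf{x}_n$ is expanded in $\{Q^{(\alpha)}_\lambda:\ell(\lambda)\le n\}$. *)

(* Defs.v *)
From HB Require Import structures.
From mathcomp Require Import all_boot all_order all_algebra all_fingroup.
From mathcomp Require Import mpoly.
Set Implicit Arguments. Unset Strict Implicit. Unset Printing Implicit Defensive.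
Import Order.TTheory GRing.Theory Num.Theory.
Local Open Scope ring_scope.

Section Defs.
Variable C : fieldType.

(* Hyperdeterminants.  The 2m indices i_1..i_m, i_{m+1}..i_{2m} are    *)
(* split into two blocks of m indices; A a b = A(a_1..a_m,b_1..b_m).   *)
Definition hyperdet (m n : nat) (A : ('I_m -> 'I_n) -> ('I_m -> 'I_n) -> C) : C :=
  (n`!%:R)^-1 *
  \sum_(s1 : {ffun 'I_m -> {perm 'I_n}}) \sum_(s2 : {ffun 'I_m -> {perm 'I_n}})
    ((\prod_(j < m) ((-1) ^+ odd_perm (s1 j) * (-1) ^+ odd_perm (s2 j))) *
     \prod_(i < n) A (fun j => s1 j i) (fun j => s2 j i)).

(* Toeplitz hyperdeterminant D_n^[2m](f) with Fourier coefficients d.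
   (0-based indices; only differences i_1+..+i_m-i_{m+1}-..-i_{2m} matter) *)
Definition toeplitz_hdet (m n : nat) (d : int -> C) : C :=
  hyperdet (fun a b : 'I_m -> 'I_n =>
     d ((\sum_(j < m) ((a j : nat)%:Z)) - (\sum_(j < m) ((b j : nat)%:Z)))%R).

Definition const_one_coef : int -> C := fun k => (k == 0)%:R.

Definition normalized_toeplitz_hdet (m n : nat) (d : int -> C) : C :=
  toeplitz_hdet m n d / toeplitz_hdet m n const_one_coef.

Definition truncF (R : nat) (d : int -> C) : int -> C :=
  fun k => if (- (R%:Z) <= k)%R then d k else 0.

(* Partitions with at most N parts, encoded as weakly decreasing       *)
(* exponent vectors lam : 'X_{1..N} (lam i = i-th part, 0-based).      *)
Section Partitions.
Variable N : nat.

Definition is_part (k : nat) (lam : 'X_{1..N}) : bool :=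
  (mdeg lam == k) && [forall i : 'I_N, forall j : 'I_N, (i <= j)%N ==> (lam j <= lam i)%N].

Definition plength (lam : 'X_{1..N}) : nat := #|[set i : 'I_N | (0 < lam i)%N]|.

Definition pconj (lam : 'X_{1..N}) (j : nat) : nat := #|[set i : 'I_N | (j <= lam i)%N]|.

Definition pmult (lam : 'X_{1..N}) (k : nat) : nat := #|[set i : 'I_N | lam i == k]|.

Definition zee (lam : 'X_{1..N}) : nat :=
  (\prod_(1 <= k < (mdeg lam).+1) (k ^ pmult lam k * (pmult lam k)`!))%N.

Definition dominated (mu lam : 'X_{1..N}) : bool :=
  [forall k : 'I_N.+1,
     (\sum_(i < N | (i < k)%N) mu i <= \sum_(i < N | (i < k)%N) lam i)%N].

Definition msymm (lam : 'X_{1..N}) : {mpoly C[N]} :=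
  \sum_(e : 'X_{1..N < (mdeg lam).+1} | perm_eq (e : 'X_{1..N}) lam) 'X_[(e : 'X_{1..N})].

Definition psum (k : nat) : {mpoly C[N]} := \sum_(i < N) 'X_i ^+ k.
Definition ppow (lam : 'X_{1..N}) : {mpoly C[N]} :=
  \prod_(i < N | (0 < lam i)%N) psum (lam i).

(* The Jack P-functions of degree k (k <= N, so that symmetric        *)
(* functions of degree k are faithfully represented in N variables):  *)
(* P lam = m_lam + sum_{mu < lam} u_{lam mu} m_mu, and the P lam are  *)
(* pairwise orthogonal for <p_lam, p_mu>_alpha = delta z_lam alpha^l. *)
(* The scalar product is computed through the (unique, since k <= N)  *)
(* expansion coefficients a lam nu of P lam in the p_nu basis.        *)
Definition is_JackP_family (alpha : C) (k : nat)
    (P : 'X_{1..N} -> {mpoly C[N]}) : Prop :=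
  (k <= N)%N /\
  (forall lam : 'X_{1..N}, is_part k lam ->
     exists u : 'X_{1..N} -> C,
       P lam = msymm lam +
         \sum_(mu : 'X_{1..N < k.+1} | is_part k mu && dominated mu lam && (mu != lam :> 'X_{1..N}))
            u mu *: msymm mu) /\
  (exists a : 'X_{1..N} -> 'X_{1..N} -> C,
     (forall lam : 'X_{1..N}, is_part k lam ->
        P lam = \sum_(nu : 'X_{1..N < k.+1} | is_part k nu) a lam nu *: ppow nu) /\
     (forall lam mu : 'X_{1..N}, is_part k lam -> is_part k mu -> lam != mu ->
        \sum_(nu : 'X_{1..N < k.+1} | is_part k nu)
           a lam nu * a mu nu * ((zee nu)%:R * alpha ^+ plength nu) = 0)).

(* c_lam(alpha), c'_lam(alpha) (boxes (i,j), i,j 1-based) *)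
Definition cfac (alpha : C) (lam : 'X_{1..N}) : C :=
  \prod_(i < N) \prod_(1 <= j < (lam i).+1)
     (alpha * ((lam i - j)%N)%:R + (pconj lam j)%:R - (i.+1)%:R + 1).
Definition cfac' (alpha : C) (lam : 'X_{1..N}) : C :=
  \prod_(i < N) \prod_(1 <= j < (lam i).+1)
     (alpha * ((lam i - j + 1)%N)%:R + (pconj lam j)%:R - (i.+1)%:R).

Definition JackQ (alpha : C) (P : 'X_{1..N} -> {mpoly C[N]}) (lam : 'X_{1..N}) :=
  (cfac alpha lam / cfac' alpha lam) *: P lam.

Definition spec_vars (n : nat) (p : {mpoly C[N]}) : {mpoly C[n]} :=
  p \mPo [tuple oapp (fun j : 'I_n => 'X_j) 0 (insub (val i) : option 'I_n) | i < N].

Definition rect (n R : nat) : 'X_{1..N} := [multinom (if (i < n)%N then R else 0%N) | i < N].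
End Partitions.

(* Homogeneous component of degree D of the formal power series       *)
(* S_f(x_1..x_n;R) = prod_k x_k^R F_R(x_k) = prod_k sum_{j>=0} dR(j-R) x_k^j *)
Definition Sf_component (n R : nat) (d : int -> C) (D : nat) : {mpoly C[n]} :=
  \sum_(e : 'X_{1..n < D.+1} | mdeg e == D)
     (\prod_(k < n) truncF R d ((e k)%:Z - R%:Z)) *: 'X_[(e : 'X_{1..n})].

End Defs.

(* Main.v *)
Require Import Defs.
From HB Require Import structures.
From mathcomp Require Import all_boot all_order all_algebra all_fingroup.
From mathcomp Require Import mpoly zify ring.
Set Implicit Arguments. Unset Strict Implicit. Unset Printing Implicit Defensive.
Import GRing.Theory Num.Theory.
Local Open Scope ring_scope.

(** Expanding the alternants turns the Toeplitz hyperdeterminant into a scalar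
    product of S_f with (x_1...x_n)^R on the torus, for the weight
    prod_(i <> j) (1 - x_i/x_j)^m.  As (x_1...x_n)^R is the Jack polynomial of (R^n),
    it suffices that it be orthogonal to the other P_lam with at most n parts, all
    of which have a part larger than R.  By the Cauchy identity and the triangularity of
    the P_lam, this follows from the orthogonality of (x_1...x_n)^R to all products g_k h
    with k > R and h any polynomial, where sum_k g_k y^k = prod_i (1 - x_i y)^(-m).
    Decomposing this product into partial fractions shows that
    g_k prod_(i <> j) (x_i - x_j)^m is in the ideal generated by the powers
    x_i^(k + m(n-1)), so that g_k h x^(-R) times the weight has no constant term.
    The normalization does not vanish because its value is a sum of squares of the
    real coefficients of the m-th power of the Vandermonde determinant. *)

(** * Products of power series in one variable y, read coefficientwise *)

Section ProductSeries.
Variables (A : comNzRingType) (n : nat).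
Implicit Types (h : 'I_n -> nat -> A) (c : 'X_{1..n}) (f : {mpoly A[n]}).

(* the coefficient of y^k in prod_i (sum_a h_i(a) (x_i y)^a) *)
Definition prodser h (k : nat) : {mpoly A[n]} :=
  \sum_(c : 'X_{1..n < k.+1} | mdeg c == k) (\prod_i h i (c i)) *: 'X_[c].

Lemma mcoeff_bsum (k : nat) (P : pred 'X_{1..n}) (E : 'X_{1..n} -> A) c :
  (forall e, P e -> mdeg e < k)%N ->
  (\sum_(e : 'X_{1..n < k} | P e) E e *: 'X_[e] : {mpoly A[n]})@_c
  = if P c then E c else 0.
Proof.
move=> Pk; rewrite raddf_sum /=; case: ifP => Pc; last first.
  rewrite big1 // => e Pe; rewrite mcoeffZ mcoeffX.
  by case: eqP Pe Pc => [-> ->//|_ _ _]; rewrite mulr0.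
have lt := Pk _ Pc.
rewrite (bigD1 (BMultinom lt)) //= mcoeffZ mcoeffX eqxx mulr1 big1 ?addr0 //.
move=> e /andP[_ ne]; rewrite mcoeffZ mcoeffX.
case: eqP => [eq|]; last by rewrite mulr0.
by case/eqP: ne; apply/val_inj.
Qed.

Lemma mcoeff_prodser h k c :
  (prodser h k)@_c = if mdeg c == k then \prod_i h i (c i) else 0.
Proof.
by rewrite /prodser (mcoeff_bsum (P := fun e => mdeg e == k) (fun e => \prod_i h i (e i))) // => e /eqP->.
Qed.

Lemma mcoeffXnM (i : 'I_n) (r : nat) f c :
  ('X_i ^+ r * f)@_c = if (r <= c i)%N then f@_(c - U_(i) *+ r)%MM else 0.
Proof.
rewrite mpolyXn mulrC; case: ifP => le.
  rewrite -{1}(submK (m := (U_(i) *+ r)%MM) (m' := c)).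
    by rewrite addmC mcoeffMX.
  apply/mnm_lepP => j; rewrite mulmnE mnm1E.
  by case: eqP => [<-|_]; rewrite ?mul1n ?mul0n.
rewrite mcoeffM big1 // => -[[a alt] [b blt]] /= /eqP eqc.
rewrite mcoeffX; case: eqP => [eqb|]; last by rewrite mulr0.
move: le; rewrite eqc -eqb mnmDE mulmnE mnm1E eqxx mul1n leq_addl //.
Qed.

Lemma mdegU_r (i : 'I_n) r : mdeg (U_(i) *+ r)%MM = r.
Proof. by rewrite mdegMn mdeg1 mul1n. Qed.

Lemma mdegB_U (i : 'I_n) r c : (r <= c i)%N ->
  mdeg (c - U_(i) *+ r)%MM = (mdeg c - r)%N.
Proof.
move=> le; rewrite -[in RHS](submK (m := (U_(i) *+ r)%MM) (m' := c)).
  by rewrite mdegD mdegU_r addnK.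
apply/mnm_lepP => j; rewrite mulmnE mnm1E.
by case: eqP => [<-|_]; rewrite ?mul1n ?mul0n.
Qed.

Lemma subUE (i j : 'I_n) r c :
  (c - U_(i) *+ r)%MM j = if j == i then (c i - r)%N else c j.
Proof.
rewrite mnmBE mulmnE mnm1E eq_sym.
by case: eqP => [->|_]; rewrite ?mul1n ?mul0n ?subn0.
Qed.

Lemma leq_mdeg c (i : 'I_n) : (c i <= mdeg c)%N.
Proof. by rewrite mdegE (bigD1 i) //= leq_addr. Qed.

(** The hypothesis says y H_i' = T H_i for each series H_i, where T = sum_r t_r y^r. Hence y times
    the logarithmic derivative of prod_i H_i(x_i y) is sum_i T(x_i y). *)
Lemma prodser_newton h (t : nat -> A) k :
  (forall i a, a%:R * h i a = \sum_(1 <= r < a.+1) t r * h i (a - r)%N) ->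
  k%:R * prodser h k
  = \sum_(1 <= r < k.+1) t r *: ((\sum_i 'X_i ^+ r) * prodser h (k - r)).
Proof.
move=> hrec; apply/mpolyP => c.
rewrite mulr_natl mcoeffMn mcoeff_prodser.
transitivity (\sum_(1 <= r < k.+1) \sum_i t r *
    (if (r <= c i)%N then (prodser h (k - r))@_(c - U_(i) *+ r)%MM else 0)); last first.
  rewrite raddf_sum /=; apply: eq_bigr => r _.
  rewrite mcoeffZ mulr_suml raddf_sum /= mulr_sumr.
  by apply: eq_bigr => i _; rewrite mcoeffXnM.
rewrite exchange_big /=; case: eqP => [ck|ck]; last first.
  rewrite mul0rn big1 // => i _; apply: big1_seq => r /=.
  rewrite mem_index_iota => /andP[r1 rk].
  case: ifP => le; last by rewrite mulr0.
  rewrite mcoeff_prodser mdegB_U //; case: eqP => [e|]; last by rewrite mulr0.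
  case: ck; have := leq_trans le (leq_mdeg c i); move: e rk.
  rewrite ltnS => e rk lec.
  by rewrite -(subnK lec) e subnK.
(* The factor k is split as the sum of the exponents [c i], and the recursion of [h i] is applied to
   the i-th share. *)
rewrite -[in LHS]ck -mulr_natl mdegE natr_sum mulr_suml; apply: eq_bigr => i _.
rewrite (bigD1 i) //= mulrA hrec mulr_suml.
have lek : ((c i).+1 <= k.+1)%N by rewrite ltnS -ck leq_mdeg.
rewrite [RHS](big_cat_nat (n := (c i).+1)) //=.
rewrite [X in _ = _ + X]big1_seq ?addr0; last first.
  move=> r /=; rewrite mem_index_iota => /andP[r1 _].
  by rewrite leqNgt r1 mulr0.
apply: eq_big_seq => r; rewrite mem_index_iota ltnS => /andP[_ rc].
rewrite rc mcoeff_prodser mdegB_U // ck eqxx.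
rewrite [X in _ = _ * X](bigD1 i) //= subUE eqxx mulrA.
by congr (_ * _); apply: eq_bigr => j /negPf ji; rewrite subUE ji.
Qed.

(** Multiplying the series of index [j] by 1 - y multiplies the whole product by 1 - x_j y. *)
Lemma prodser_mul1 h h' (j : 'I_n) k :
  (forall i, i != j -> h' i =1 h i) -> h' j 0%N = h j 0%N ->
  (forall a, h' j a.+1 = h j a.+1 - h j a) ->
  prodser h' k.+1 = prodser h k.+1 - 'X_j * prodser h k.
Proof.
move=> hi h0 hS; apply/mpolyP => c; rewrite mcoeffB -['X_j]expr1 mcoeffXnM.
rewrite !mcoeff_prodser; case: ltnP => cj.
  rewrite mdegB_U //.
  have -> : (mdeg c - 1 == k)%N = (mdeg c == k.+1).
    by have := leq_trans cj (leq_mdeg c j); case: (mdeg c) => // d _; rewrite subn1.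
  case: eqP => // _; last by rewrite subr0.
  rewrite (bigD1 j) //= [X in _ = X - _](bigD1 j) //= [X in _ = _ - X](bigD1 j) //=.
  rewrite subUE eqxx; case: (c j) cj => // a _; rewrite subn1 /= hS mulrBl.
  congr (_ * _ - _ * _); apply: eq_bigr => i ij; rewrite ?hi //.
  by rewrite subUE (negPf ij).
rewrite subr0; case: eqP => // _; apply: eq_bigr => i _.
have [->|ij] := eqVneq i j; last by rewrite hi.
by move: cj; rewrite leqn0 => /eqP->.
Qed.

(* membership in the ideal generated by the K-th powers of the variables *)
Definition high (K : nat) f := forall c, (forall i, c i < K)%N -> f@_c = 0.

Lemma highB K f f' : high K f -> high K f' -> high K (f - f').
Proof. by move=> hf hf' c cK; rewrite mcoeffB hf // hf' // subrr. Qed.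

Lemma highM K f f' : high K f -> high K (f' * f).
Proof.
move=> hf c cK; rewrite mcoeffM big1 // => -[[a alt] [b blt]] /= /eqP eqc.
rewrite [X in _ * X]hf ?mulr0 // => i.
by apply: leq_ltn_trans (cK i); rewrite eqc mnmDE leq_addl.
Qed.

Lemma highW K K' f : (K' <= K)%N -> high K f -> high K' f.
Proof. by move=> le hf c cK; apply: hf => i; apply: leq_trans (cK i) le. Qed.

End ProductSeries.

(** * Partial fractions of prod_i (1 - x_i y)^(-a_i) *)

Section Discriminant.
Variables (A : idomainType) (n : nat).
Implicit Types (a c : 'X_{1..n}) (f : {mpoly A[n]}).

(* The coefficient of y^c in (1 - y)^(-a); the truncated predecessor makes this
   correct also for a = 0. *)
Definition negbin (a c : nat) : nat := 'C((a + c).-1, c).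

(** Coefficientwise form of y F' = a (y + y^2 + ...) F for F = (1 - y)^(-a). *)
Lemma negbin_rec (a c : nat) :
  (c * negbin a c = \sum_(1 <= r < c.+1) a * negbin a (c - r))%N.
Proof.
case: a => [|a].
  rewrite big1 // /negbin; case: c => [|c]; first by rewrite mul0n.
  by rewrite add0n bin_small // muln0.
elim: c => [|c IH]; first by rewrite mul0n big_geq.
rewrite big_ltn // big_add1 /=.
under eq_bigr => r _ do rewrite subSS.
rewrite -IH subn1 /negbin !addSn /= addnS /=.
have := mul_bin_diag (a + c) c; rewrite binS => e.
have := mul_bin_left (a + c) c; rewrite addnK; nia.
Qed.

Definition mulser a (k : nat) : {mpoly A[n]} :=
  prodser (fun i (b : nat) => (negbin (a i) b)%:R) k.

Lemma mulser_step a (j : 'I_n) k : (0 < a j)%N ->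
  mulser (a - U_(j))%MM k.+1 = mulser a k.+1 - 'X_j * mulser a k.
Proof.
move=> aj; apply: prodser_mul1.
- by move=> i ij c; rewrite mnmBE mnm1E eq_sym (negPf ij) subn0.
- by rewrite /negbin !bin0.
move=> c; rewrite mnmBE mnm1E eqxx; case: (a j) aj => // b _.
by rewrite subn1 /negbin !addSn /= !addnS /= binS natrD addrK.
Qed.

(** Denominators of the partial fractions: one [diffprod i] is spent each time the exponent of 1 -
    x_i y is lowered. With all exponents equal to m, [diffpow] is up to sign the 2m-th power of the
    Vandermonde determinant. *)
Definition diffprod (i : 'I_n) : {mpoly A[n]} := \prod_(j | j != i) ('X_i - 'X_j).
Definition diffpow a : {mpoly A[n]} := \prod_i diffprod i ^+ a i.

Lemma diffpow_step a (j : 'I_n) : (0 < a j)%N ->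
  diffpow a = diffprod j * diffpow (a - U_(j))%MM.
Proof.
move=> aj; rewrite /diffpow (bigD1 j) //= [in RHS](bigD1 j) //= mulrA -exprS.
rewrite mnmBE mnm1E eqxx subn1 prednK //; congr (_ * _).
by apply: eq_bigr => i ij; rewrite mnmBE mnm1E eq_sym (negPf ij) subn0.
Qed.

Lemma mpolyX_subr_neq0 (i j : 'I_n) : i != j -> 'X_i - 'X_j != 0 :> {mpoly A[n]}.
Proof.
move=> ij; apply/eqP => /(congr1 (mcoeff U_(i)%MM)).
rewrite mcoeffB !mcoeffXU mcoeff0 eqxx eq_sym (negPf ij) subr0.
by apply/eqP/oner_neq0.
Qed.

(* The generating function prod_i (1 - x_i y)^(-a_i) of [mulser a] is
   decomposed into partial fractions with the identity
   (x_i - x_j) y / ((1 - x_i y) (1 - x_j y)) = 1/(1 - x_i y) - 1/(1 - x_j y). *)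
Lemma high_diffpow_mulser m a k : a != 0%MM -> (forall i, a i <= m)%N ->
  high (k + mdeg a - m) (diffpow a * mulser a k).
Proof.
elim/ltn_ind: {a}(mdeg a) {-2}a (erefl (mdeg a)) k => s IH a deg_a k a0 am.
have [i ai] : exists i, (0 < a i)%N.
  apply/existsP; apply: contraNT a0 => /existsPn a0; apply/eqP/mnmP => i.
  by apply/eqP; rewrite mnm0E -leqn0 leqNgt a0.
case: (boolP [exists j, (j != i) && (0 < a j)%N]) => [/existsP[j /andP[ji aj]]|/existsPn single].
  have ij : i != j by rewrite eq_sym.
  (* Lowering one exponent while raising k by one leaves the bound k + s - m unchanged. *)
  have step l (j' : 'I_n) : (j' != l) -> (0 < a l)%N -> (0 < a j')%N ->
      high (k + s - m) (diffpow (a - U_(l))%MM * mulser (a - U_(l))%MM k.+1).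
    move=> jl al aj'; have dl : mdeg (a - U_(l))%MM = s.-1.
      by have := mdegB_U al; rewrite deg_a subn1.
    have sp : (0 < s)%N by rewrite -deg_a (leq_trans al) ?leq_mdeg.
    have := IH _ _ _ dl k.+1; rewrite dl addSn -addnS prednK //; apply=> //.
      apply/eqP => /mnmP/(_ j'); rewrite mnmBE mnm1E eq_sym (negPf jl) subn0 mnm0E.
      by move=> e; rewrite e in aj'.
    by move=> t; rewrite mnmBE (leq_trans _ (am t)) // leq_subr.
  have Hi := step i j ji ai aj; have Hj := step j i ij aj ai.
  rewrite deg_a.
  set di := \prod_(l | (l != i) && (l != j)) ('X_i - 'X_l) : {mpoly A[n]}.
  set dj := \prod_(l | (l != j) && (l != i)) ('X_j - 'X_l) : {mpoly A[n]}.
  have ei : diffpow a = ('X_i - 'X_j) * (di * diffpow (a - U_(i))%MM).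
    by rewrite (diffpow_step ai) /diffprod (bigD1 j) //= !mulrA.
  have ej : diffpow a = ('X_i - 'X_j) * (- dj * diffpow (a - U_(j))%MM).
    by rewrite (diffpow_step aj) /diffprod (bigD1 i) //= mulNr mulrN -mulNr opprB !mulrA.
  have eij : di * diffpow (a - U_(i))%MM = - dj * diffpow (a - U_(j))%MM.
    by apply: (mulfI (mpolyX_subr_neq0 ij)); rewrite -ei -ej.
  (* As (1 - x_j y) - (1 - x_i y) = (x_i - x_j) y, the factor x_i - x_j of [diffpow a] turns the
     coefficient of y^k into a difference of two coefficients of y^(k+1). *)
  have -> : diffpow a * mulser a k =
     (- dj) * (diffpow (a - U_(j))%MM * mulser (a - U_(j))%MM k.+1)
     - di * (diffpow (a - U_(i))%MM * mulser (a - U_(i))%MM k.+1).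
    rewrite [in LHS]ei !mulrA -eij !mulser_step // -!mulrA; ring.
  by apply: highB; apply: highM.
(* With a single nonzero exponent [a i], [mulser a k] is a multiple of x_i^k, and k + a_i - m <=
   k. *)
have a0' l : l != i -> a l = 0%N.
  by move=> li; apply/eqP; have := single l; rewrite li /= lt0n negbK.
apply: highM; apply: (@highW _ _ k).
  rewrite mdegE (bigD1 i) //= big1 ?addn0 //.
  by have := am i; lia.
move=> c ck; rewrite mcoeff_prodser; case: eqP => // dk.
have [l li cl] : exists2 l, l != i & (0 < c l)%N.
  apply/exists_inP; apply: contraT => /exists_inPn cz.
  have := ck i; rewrite -dk mdegE (bigD1 i) //= big1 ?addn0 ?ltnn // => l li.
  by apply/eqP; rewrite -leqn0 leqNgt cz.
rewrite (bigD1 l) //= a0' // /negbin add0n bin_small ?mul0r //.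
by case: (c l) cl.
Qed.

End Discriminant.

(** * Powers of the Vandermonde determinant and the torus scalar product *)

Lemma mcoeffXM (A : comNzRingType) n (f : {mpoly A[n]}) (q c : 'X_{1..n}) :
  ('X_[q] * f)@_c = if (q <= c)%MM then f@_(c - q) else 0.
Proof.
case: ifP => [le|]; first by rewrite -{1}(submK le) addmC mulrC mcoeffMX.
apply: contraFeq; rewrite -mcoeff_msupp => /msuppM_le /allpairsP[[a b] /= [sa _ ->]].
by move: sa; rewrite msuppX mem_seq1 => /eqP->; apply: lem_addr.
Qed.

Section Alternant.
Variables (C : idomainType) (m n : nat).

Definition alternant (F : nat -> nat) : {mpoly C[n]} :=
  \sum_(s : 'S_n) (-1) ^+ odd_perm s *: 'X_[[multinom F (s i) | i < n]].

Definition sgn_family (s : {ffun 'I_m -> 'S_n}) : C :=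
  \prod_(j < m) (-1) ^+ odd_perm (s j).

(** Exponent of the monomial obtained by choosing the term [s j] in the j-th of m alternants; for
    [F] = [id] it is also the vector of index sums in the hyperdeterminant. *)
Definition family_exp (F : nat -> nat) (s : {ffun 'I_m -> 'S_n}) : 'X_{1..n} :=
  [multinom (\sum_(j < m) F (s j i))%N | i < n].

Lemma alternant_exp F :
  alternant F ^+ m = \sum_s sgn_family s *: 'X_[family_exp F s].
Proof.
have -> : alternant F ^+ m = \prod_(j < m) alternant F by rewrite prodr_const card_ord.
rewrite /alternant bigA_distr_bigA /=; apply: eq_bigr => s _.
rewrite scaler_prod; congr (_ *: _).
rewrite mprodXE; apply: congr1; apply/mnmP => i; rewrite mnm_sumE mnmE.
by apply: eq_bigr => j _; rewrite mnmE.
Qed.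

Lemma alternant_id_Vandermonde :
  alternant id = \prod_(i < n) \prod_(j < n | (i < j)%N) ('X_j - 'X_i).
Proof.
pose a : 'rV[{mpoly C[n]}]_n := \row_i 'X_i.
transitivity (\det (Vandermonde n a)); last first.
  rewrite det_Vandermonde; apply: eq_bigr => i _.
  by apply: eq_bigr => j _; rewrite !mxE.
rewrite -det_tr; apply: eq_bigr => s _.
rewrite -mul_mpolyC rmorphXn rmorphN1; congr (_ * _).
rewrite mpolyXE_id; apply: eq_bigr => i _.
by rewrite !mxE mnmE.
Qed.

Lemma alternant_id_neq0 : alternant id != 0.
Proof.
rewrite alternant_id_Vandermonde; apply/prodf_neq0 => i _.
apply/prodf_neq0 => j ij; apply: mpolyX_subr_neq0.
by apply: contraTneq ij => ->; rewrite ltnn.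
Qed.

(** The reversed alternant is (x_1...x_n)^(n-1) times the Vandermonde determinant in the inverse
    variables. Multiplying all permutations by the reversal costs only its sign. *)
Lemma alternant_rev : exists e : bool,
  alternant (fun k => n.-1 - k)%N = (-1) ^+ e *: alternant id.
Proof.
pose r : 'S_n := perm (@rev_ord_inj n); exists (odd_perm r).
rewrite /alternant (reindex_inj (mulIg r)) /= scaler_sumr.
apply: eq_bigr => s _; rewrite odd_permM scalerA -signr_addb addbC; congr (_ *: _).
apply: congr1; apply/mnmP => i; rewrite !mnmE permM permE /=.
by have := ltn_ord (s i); lia.
Qed.

Lemma alternant_sqr_diffprod : exists c : {mpoly C[n]},
  alternant id ^+ 2 = c * \prod_i diffprod C i.
Proof.
exists (\prod_(i < n) \prod_(j < n | (i < j)%N) (-1)).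
have -> : \prod_i diffprod C i =
  (\prod_(i < n) \prod_(j < n | (i < j)%N) ('X_i - 'X_j)) *
  (\prod_(i < n) \prod_(j < n | (i < j)%N) ('X_j - 'X_i)) :> {mpoly C[n]}.
  rewrite [X in _ = _ * X](exchange_big_dep xpredT) //= -big_split /=.
  apply: eq_bigr => i _; rewrite /diffprod (bigID (fun j : 'I_n => (i < j)%N)) /=.
  congr (_ * _); apply: eq_bigl => j; rewrite -(inj_eq val_inj) /=; lia.
rewrite mulrA -big_split /= alternant_id_Vandermonde expr2; congr (_ * _).
apply: eq_bigr => i _; rewrite -big_split /=.
by apply: eq_bigr => j _; rewrite mulN1r opprB.
Qed.

(* [n!] times the scalar product of [f] with (x_1...x_n)^R on the torus, whose
   weight prod_{i <> j} (1 - x_i / x_j)^m has been multiplied by (x_1...x_n)^(m(n-1)). *)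
Definition torus (R : nat) (f : {mpoly C[n]}) : C :=
  (alternant id ^+ m * alternant (fun k => n.-1 - k)%N ^+ m * f)
    @_[multinom (R + m * n.-1)%N | i < n].

Lemma torusE R f : torus R f = \sum_(s2 : {ffun 'I_m -> 'S_n}) \sum_(s1 : {ffun 'I_m -> 'S_n})
  sgn_family s2 * sgn_family s1 *
  let q := (family_exp id s2 + family_exp (fun k => n.-1 - k)%N s1)%MM in
  let M := [multinom (R + m * n.-1)%N | i < n] in
  if (q <= M)%MM then f@_(M - q) else 0.
Proof.
rewrite /torus !alternant_exp !mulr_suml raddf_sum; apply: eq_bigr => s2 _.
rewrite mulr_sumr mulr_suml raddf_sum; apply: eq_bigr => s1 _.
by rewrite /= -!scalerAl -scalerAr -scalerAl !mcoeffZ mulrA -mpolyXD mcoeffXM.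
Qed.

Lemma torusZ R a f : torus R (a *: f) = a * torus R f.
Proof. by rewrite /torus -scalerAr mcoeffZ. Qed.

Lemma torus_sum R (I : Type) (r : seq I) (P : pred I) (F : I -> {mpoly C[n]}) :
  torus R (\sum_(i <- r | P i) F i) = \sum_(i <- r | P i) torus R (F i).
Proof. by rewrite /torus mulr_sumr raddf_sum. Qed.

(** The weight puts the product into the ideal generated by the x_i^(k + m(n-1)), whereas the
    extracted monomial has all exponents equal to the smaller R + m(n-1). *)
Lemma torus_eq0 R k f : (0 < m)%N -> (0 < n)%N -> (R < k)%N ->
  torus R (mulser C [multinom m | i < n] k * f) = 0.
Proof.
move=> m_gt0 n_gt0 Rk; rewrite /torus.
have [e ->] := alternant_rev; rewrite exprZn -scalerAr -!scalerAl mcoeffZ.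
rewrite -exprMn -expr2; have [q ->] := alternant_sqr_diffprod.
rewrite exprMn -prodrXl.
have -> : \prod_i diffprod C i ^+ m = diffpow C [multinom m | i < n].
  by apply: eq_bigr => i _; rewrite mnmE.
set a := [multinom m | i < n].
have -> : q ^+ m * diffpow C a * (mulser C a k * f) = q ^+ m * f * (diffpow C a * mulser C a k).
  ring.
have deg_a : mdeg a = (m * n)%N.
  by rewrite mdegE (eq_bigr (fun=> m)) ?sum_nat_const ?card_ord 1?mulnC // => i _; rewrite mnmE.
rewrite (highM (q ^+ m * f) (K := (k + m * n - m)%N)) ?mulr0 //.
  rewrite -deg_a; apply: high_diffpow_mulser => [|i]; last by rewrite mnmE.
  by rewrite -mdeg_eq0 deg_a -lt0n muln_gt0 m_gt0.
move=> i; rewrite mnmE; case: (n) n_gt0 => // n' _ /=; rewrite mulnS; lia.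
Qed.
End Alternant.

(** * Toeplitz hyperdeterminants as torus scalar products *)

Lemma sum_perm n (s : 'S_n) (F : nat -> nat) : (\sum_i F (s i) = \sum_(i < n) F i)%N.
Proof. by rewrite [RHS](reindex_inj (@perm_inj _ s)). Qed.

Section Toeplitz.
Variables (C : fieldType) (m n : nat).

Lemma toeplitz_hdetE (d : int -> C) : toeplitz_hdet m n d = (n`!%:R)^-1 *
  \sum_(s1 : {ffun 'I_m -> 'S_n}) \sum_(s2 : {ffun 'I_m -> 'S_n})
    sgn_family C s1 * sgn_family C s2 *
    \prod_i d ((family_exp id s1 i)%:Z - (family_exp id s2 i)%:Z).
Proof.
congr (_ * _); apply: eq_bigr => s1 _; apply: eq_bigr => s2 _.
rewrite /sgn_family -big_split /=; congr (_ * _).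
apply: eq_bigr => i _; rewrite !mnmE.
by congr (d (_ - _)); rewrite (big_morph Posz PoszD (erefl _)).
Qed.

Lemma family_exp_rev (s : {ffun 'I_m -> 'S_n}) (i : 'I_n) :
  (family_exp (fun k => n.-1 - k) s i + family_exp id s i = m * n.-1)%N.
Proof.
rewrite !mnmE -big_split -[in RHS](card_ord m) -sum_nat_const.
by apply: eq_bigr => j _ /=; have := ltn_ord (s j i); lia.
Qed.

Lemma mdeg_family_exp F (s : {ffun 'I_m -> 'S_n}) :
  mdeg (family_exp F s) = (m * \sum_(i < n) F i)%N.
Proof.
rewrite mdegE; under eq_bigr => i _ do rewrite mnmE.
rewrite exchange_big -[in RHS](card_ord m) -sum_nat_const.
by apply: eq_bigr => j _; rewrite sum_perm.
Qed.

Lemma mcoeff_Sf_component R (d : int -> C) D c :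
  (Sf_component n R d D)@_c =
    if mdeg c == D then \prod_(k < n) truncF R d ((c k)%:Z - R%:Z) else 0.
Proof.
rewrite /Sf_component.
rewrite (mcoeff_bsum (P := fun e => mdeg e == D)
  (fun e => \prod_(k < n) truncF R d ((e k)%:Z - R%:Z))) // => e /eqP->; exact: ltnSn.
Qed.

(** Once a monomial is chosen from each alternant power, the exponent left to S_f is R plus a
    difference of index sums. These differences add up to zero, so only degree nR matters. *)
Lemma toeplitz_hdet_torus R (d : int -> C) :
  toeplitz_hdet m n (truncF R d) = (n`!%:R)^-1 * torus m R (Sf_component n R d (n * R)).
Proof.
rewrite toeplitz_hdetE torusE; congr (_ * _); rewrite exchange_big.
apply: eq_bigr => s2 _; apply: eq_bigr => s1 _.
rewrite [sgn_family C s1 * _]mulrC; congr (_ * _) => /=.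
case: ifP => [/mnm_lepP le|]; last first.
  (* Some difference of index sums lies below -R, where the truncated coefficient vanishes. *)
  move/negbT/mnm_lepP => nle.
  have [i ni] : exists i, ~~ (family_exp id s2 i + family_exp (fun k => n.-1 - k)%N s1 i <= R + m * n.-1)%N.
    apply/existsP; apply: contra_notT nle => /existsPn le i.
    by have := le i; rewrite negbK mnmDE [in X in _ -> X]mnmE.
  rewrite (bigD1 i) //= [X in X * _](_ : _ = 0) ?mul0r // /truncF ifF //.
  have e := family_exp_rev s1 i; lia.
rewrite mcoeff_Sf_component.
rewrite ifT; last first.
  apply/eqP; apply: (@addIn (mdeg (family_exp id s2 + family_exp (fun k => n.-1 - k)%N s1)%MM)).
  rewrite -mdegD submK; last by apply/mnm_lepP.
  rewrite mdegD !mdeg_family_exp -mulnDr -big_split /=.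
  have -> : (\sum_(i < n) (i + (n.-1 - i)) = n * n.-1)%N.
    rewrite -[in RHS](card_ord n) -sum_nat_const; apply: eq_bigr => i _.
    by have := ltn_ord i; rewrite card_ord; lia.
  rewrite mdegE (eq_bigr (fun=> R + m * n.-1)%N) => [|i _]; last by rewrite mnmE.
  by rewrite sum_nat_const card_ord; nia.
apply: eq_bigr => i _; congr (truncF _ _ _).
have e := family_exp_rev s1 i; have := le i; rewrite mnmBE !mnmDE.
rewrite ![in X in (_ <= X)%N]mnmE => le'; rewrite [X in (X - _)%N]mnmE; lia.
Qed.

Lemma Sf_const_one R :
  Sf_component n R (@const_one_coef C) (n * R) = 'X_[[multinom R | i < n]].
Proof.
apply/mpolyP => c; rewrite mcoeff_Sf_component.
rewrite mcoeffX; have [<-|ne] := eqVneq [multinom R | i < n] c.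
  rewrite ifT; last first.
    rewrite mdegE (eq_bigr (fun=> R)) => [|i _]; last by rewrite mnmE.
    by rewrite sum_nat_const card_ord.
  by rewrite big1 // => i _; rewrite mnmE /truncF /const_one_coef subrr eqxx ifT // oppr_le0.
case: ifP => // _.
have [i ci] : exists i, c i != R.
  apply/existsP; apply: contraNT ne => /existsPn h; apply/eqP/mnmP => i.
  by have := h i; rewrite mnmE negbK => /eqP.
rewrite (bigD1 i) //= /truncF /const_one_coef subr_eq0 eqz_nat (negPf ci).
by case: ifP; rewrite mul0r.
Qed.

Lemma truncF_const_one R : truncF R (@const_one_coef C) =1 @const_one_coef C.
Proof.
move=> k; rewrite /truncF /const_one_coef; case: ifP => // /negP h.
by case: eqP => // k0; case: h; rewrite k0 oppr_le0.
Qed.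

(** Truncation does not change the constant function 1, so [R] can be chosen freely here. *)
Lemma toeplitz_hdet_const_one R :
  toeplitz_hdet m n (@const_one_coef C) = (n`!%:R)^-1 * torus m R ('X_[[multinom R | i < n]] : {mpoly C[n]}).
Proof.
rewrite -Sf_const_one -toeplitz_hdet_torus !toeplitz_hdetE; congr (_ * _).
apply: eq_bigr => s1 _; apply: eq_bigr => s2 _; congr (_ * _).
by apply: eq_bigr => i _; rewrite truncF_const_one.
Qed.

End Toeplitz.

Lemma toeplitz_hdet_const_one_neq0 (C : numClosedFieldType) m n :
  toeplitz_hdet m n (@const_one_coef C) != 0.
Proof.
pose t (s : {ffun 'I_m -> 'S_n}) := family_exp id s.
pose K := (m * \sum_(i < n) i).+1.
have t_lt s : (mdeg (t s) < K)%N by rewrite mdeg_family_exp ltnSn.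
(* [v c] is the coefficient of x^c in [alternant id ^+ m]. *)
pose v (c : 'X_{1..n < K}) : C := \sum_(s | t s == c) sgn_family C s.
rewrite toeplitz_hdetE mulf_neq0 ?invr_eq0 ?pnatr_eq0 -?lt0n ?fact_gt0 //.
have -> : \sum_(s1 : {ffun 'I_m -> 'S_n}) \sum_(s2 : {ffun 'I_m -> 'S_n})
    sgn_family C s1 * sgn_family C s2 *
    \prod_i const_one_coef C ((family_exp id s1 i)%:Z - (family_exp id s2 i)%:Z)
    = \sum_c v c ^+ 2.
  pose bm s := BMultinom (t_lt s).
  have vE c : v c = \sum_s (c == bm s)%:R * sgn_family C s.
    rewrite /v big_mkcond; apply: eq_bigr => s _; rewrite -[c == bm s]val_eqE /= eq_sym.
    by case: eqP; rewrite ?mul1r ?mul0r.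
  (* Only pairs of families with the same exponent contribute; they are grouped by this exponent
     c. *)
  transitivity (\sum_c \sum_s1 \sum_s2 (c == bm s1)%:R *
    (sgn_family C s1 * sgn_family C s2 * (c == bm s2)%:R)); last first.
    apply: eq_bigr => c _; rewrite expr2 vE mulr_suml; apply: eq_bigr => s1 _.
    rewrite mulr_sumr; apply: eq_bigr => s2 _; ring.
  rewrite [RHS]exchange_big; apply: eq_bigr => s1 _.
  rewrite [RHS]exchange_big; apply: eq_bigr => s2 _.
  rewrite (bigD1 (bm s1)) //= eqxx mul1r [X in _ = _ + X]big1 ?addr0; last first.
    by move=> c /negPf->; rewrite mul0r.
  congr (_ * _); rewrite -[_ == bm s2]val_eqE /=; case: eqP => [e|ne].
    by rewrite big1 // => i _; rewrite -[family_exp id s1]/(t s1) e subrr /const_one_coef eqxx.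
  have [i ci] : exists i, t s1 i != t s2 i.
    apply/existsP; apply: contra_notT ne => /existsPn h; apply/mnmP => i.
    by have := h i; rewrite negbK => /eqP.
  by rewrite (bigD1 i) //= /const_one_coef subr_eq0 eqz_nat (negPf ci) mul0r.
have vreal c : v c \is Num.real.
  by apply: rpred_sum => s _; apply: rpred_prod => j _; rewrite rpredX // rpredN rpred1.
rewrite psumr_eq0 => [|c _]; last by rewrite real_exprn_even_ge0.
apply/negP => /allP v0.
have := expf_neq0 m (@alternant_id_neq0 C n); rewrite alternant_exp => /eqP; apply.
apply/mpolyP => c; rewrite mcoeff0 raddf_sum /=.
case: (ltnP (mdeg c) K) => cK.
  have := v0 (BMultinom cK) (mem_index_enum _); rewrite /= sqrf_eq0 => /eqP vc; rewrite -[RHS]vc.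
  rewrite /v [RHS]big_mkcond; apply: eq_bigr => s _ /=; rewrite mcoeffZ mcoeffX.
  by case: eqP; rewrite ?mulr1 ?mulr0.
rewrite big1 // => s _; rewrite mcoeffZ mcoeffX; case: eqP => [e|]; last by rewrite mulr0.
by have := t_lt s; rewrite /t e ltnNge cK.
Qed.

(** * Partitions encoded by multiplicities *)

Section Multiplicities.
Variable N : nat.
Implicit Types nu e : 'X_{1..N}.

(** The variable of index i stands for the power sum p_(i+1), so this is the exponent of p_nu as a
    monomial in the power sums. *)
Definition mult_mnm nu : 'X_{1..N} := [multinom pmult nu i.+1 | i < N].

Lemma big_parts (T : Type) (idx : T) (op : Monoid.com_law idx) (f : nat -> T) nu :
  (forall i, nu i <= N)%N ->
  \big[op/idx]_(i < N | (0 < nu i)%N) f (nu i)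
  = \big[op/idx]_(k < N) \big[op/idx]_(i < N | nu i == k.+1) f k.+1.
Proof.
case: N nu => [|N'] nu le; first by rewrite !big_ord0.
rewrite (partition_big (fun i => inord (nu i).-1 : 'I_N'.+1) xpredT) //=.
apply: eq_bigr => k _; apply: eq_big => i.
  have [->|nz] := posnP (nu i); first by [].
  rewrite -(inj_eq val_inj) /= inordK; last by rewrite prednK.
  by rewrite -eqSS prednK.
by move=> /andP[nz /eqP<-]; rewrite inordK prednK.
Qed.

Lemma pmultE nu k : pmult nu k = count_mem k nu.
Proof.
rewrite /pmult cardsE cardE -[in RHS](map_tnth_enum (multinom_val nu)) [RHS]count_map.
by rewrite -size_filter /enum_mem -filter_predI; congr size; apply: eq_filter => i; rewrite /= andbT.
Qed.

Lemma prod_parts (S : comPzSemiRingType) (f : nat -> S) nu :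
  (forall i, nu i <= N)%N ->
  \prod_(i < N | (0 < nu i)%N) f (nu i) = \prod_(k < N) f k.+1 ^+ mult_mnm nu k.
Proof.
move=> le; rewrite (big_parts _ _ le); apply: eq_bigr => k _.
by rewrite prodr_const mnmE /pmult cardsE.
Qed.

Lemma mdeg_mnmwgt nu : (forall i, nu i <= N)%N -> mdeg nu = mnmwgt (mult_mnm nu).
Proof.
move=> le; rewrite mdegE (bigID (fun i => 0 < nu i)%N) /= [X in (_ + X)%N]big1 ?addn0.
  rewrite (big_parts _ id le); apply: eq_bigr => k _.
  by rewrite sum_nat_const mnmE /pmult cardsE.
by move=> i; rewrite lt0n negbK => /eqP.
Qed.

Lemma part_leq D nu i : is_part D nu -> (nu i <= D)%N.
Proof. by move=> /andP[/eqP<- _]; apply: leq_mdeg. Qed.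

Lemma part_sorted D nu : is_part D nu -> sorted geq nu.
Proof.
move=> /andP[_ /forallP mono]; apply/(sortedP 0%N) => i; rewrite size_tuple => ltN.
have := mono (Ordinal (ltnW ltN)) => /forallP/(_ (Ordinal ltN)).
by rewrite /= leqnSn /= !(mnm_nth 0).
Qed.

Lemma sorted_part nu : sorted geq nu -> is_part (mdeg nu) nu.
Proof.
move=> st; rewrite /is_part eqxx; apply/forallP => i; apply/forallP => j; apply/implyP => ij.
have := sorted_leq_nth (leT := geq) _ _ 0%N st.
move=> /(_ (fun x y z xy yz => leq_trans yz xy) leqnn i j).
by rewrite !inE !size_tuple !ltn_ord !(mnm_nth 0); apply.
Qed.

(** Parts are at most D <= N, so the multiplicities of 1, ..., N determine that of 0 as well; sorted
    sequences with equal counts coincide. *)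
Lemma mult_mnm_inj D nu nu' : (D <= N)%N -> is_part D nu -> is_part D nu' ->
  mult_mnm nu = mult_mnm nu' -> nu = nu'.
Proof.
move=> DN nuP nuP' eq_mult.
have le i : (nu i <= N)%N by rewrite (leq_trans (part_leq i nuP)).
have le' i : (nu' i <= N)%N by rewrite (leq_trans (part_leq i nuP')).
have eqS k : (k < N)%N -> count_mem k.+1 nu = count_mem k.+1 nu'.
  by move=> kN; have /mnmP/(_ (Ordinal kN)) := eq_mult; rewrite !mnmE !pmultE.
have count0 (mu : 'X_{1..N}) : (forall i, mu i <= N)%N ->
    count_mem 0%N mu = (N - \sum_(k < N) mult_mnm mu k)%N.
  move=> lemu; rewrite (eq_bigr (fun k : 'I_N => \sum_(i < N | mu i == k.+1) 1)%N); last first.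
    by move=> k _; rewrite mnmE /pmult cardsE sum1_card.
  rewrite -(big_parts _ (fun=> 1%N) lemu) -pmultE /pmult.
  have := cardC [set i | mu i == 0%N]; rewrite card_ord => cN; rewrite -[X in (X - _)%N]cN.
  rewrite sum1_card [X in (_ = _ + X - _)%N](_ : _ = #|(fun i : 'I_N => 0 < mu i)%N|) ?addnK //.
  by apply: eq_card => i; rewrite !inE -lt0n.
have eqc k : count_mem k nu = count_mem k nu'.
  case: k => [|k]; first by rewrite !count0 // eq_mult.
  have [kN|kN] := ltnP k N; first exact: eqS.
  have cz (mu : 'X_{1..N}) : (forall i, mu i <= N)%N -> count_mem k.+1 mu = 0%N.
    move=> lemu; apply/count_memPn/negP => /tnthP[i e].
    by have := lemu i; rewrite mnm_tnth -e leqNgt ltnS kN.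
  by rewrite !cz.
apply/val_inj/val_inj; apply: (sorted_eq (leT := geq)).
- by move=> x y z yx xz; apply: leq_trans xz yx.
- by move=> x y /andP[yx xy]; apply/eqP; rewrite eqn_leq; apply/andP.
- exact: part_sorted nuP.
- exact: part_sorted nuP'.
by apply/allP => k _ /=; rewrite eqc.
Qed.

Lemma mult_mnm_surj D e : (D <= N)%N -> mnmwgt e = D ->
  exists2 nu, is_part D nu & mult_mnm nu = e.
Proof.
move=> DN wgt_e.
(* The list has [e k] copies of each k+1. Its length is at most the weight of [e], hence at most N,
   which leaves room for padding with zeros. *)
pose s0 := flatten [seq nseq (e k) k.+1 | k <- enum 'I_N].
have size_s0 : (size s0 <= N)%N.
  apply: leq_trans DN; rewrite -wgt_e size_flatten sumnE 2!big_map big_enum /=.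
  by apply: leq_sum => k _; rewrite size_nseq leq_pmulr.
pose s := sort geq (s0 ++ nseq (N - size s0) 0%N).
have size_s : size s == N by rewrite size_sort size_cat size_nseq subnKC.
pose nu := Multinom (Tuple size_s).
have le i : (nu i <= N)%N.
  have : nu i \in s by rewrite mnm_tnth mem_tnth.
  rewrite mem_sort mem_cat mem_nseq => /orP[/flatten_mapP[k _]|/andP[_ /eqP->//]].
  by rewrite mem_nseq => /andP[_ /eqP->].
have mult_nu : mult_mnm nu = e.
  apply/mnmP => k; rewrite mnmE pmultE /= count_sort count_cat count_nseq /= mul0n addn0.
  rewrite count_flatten sumnE 2!big_map big_enum (bigD1 k) //= count_nseq /= eqxx mul1n.
  rewrite big1 ?addn0 // => j jk; rewrite count_nseq /= eqSS.
  by rewrite (inj_eq val_inj) (negPf jk).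
exists nu => //; rewrite -wgt_e -mult_nu -mdeg_mnmwgt //.
apply: sorted_part; apply: sort_sorted => x y; exact: leq_total.
Qed.

Lemma zeeE D nu : (D <= N)%N -> is_part D nu ->
  zee nu = (\prod_(k < N) (k.+1 ^ mult_mnm nu k * (mult_mnm nu k)`!))%N.
Proof.
move=> DN nuP; have [/eqP deg_nu _] := andP nuP; rewrite /zee deg_nu.
pose F k := (k.+1 ^ pmult nu k.+1 * (pmult nu k.+1)`!)%N.
rewrite big_add1 /= -/F (eq_bigr (fun k : 'I_N => F k)) => [|k _]; last by rewrite mnmE.
rewrite -(big_mkord xpredT F) [RHS](big_cat_nat (n := D)) //= [X in (_ * X)%N]big1_seq ?muln1 //.
move=> k; rewrite mem_index_iota => /andP[_ /andP[Dk _]].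
rewrite /F (_ : pmult nu k.+1 = 0%N) // /pmult; apply/eqP; rewrite cards_eq0.
apply/eqP/setP => i; rewrite !inE; apply/negbTE; rewrite neq_ltn ltnS.
by rewrite (leq_trans (part_leq i nuP)).
Qed.


End Multiplicities.

(** * Complete symmetric functions in terms of power sums *)

Section CycleIndex.
Variables (C : numFieldType) (N : nat).
Implicit Types (e nu : 'X_{1..N}).

Definition cycle_weight e : nat := (\prod_(i < N) (i.+1 ^ e i * (e i)`!))%N.

Lemma cycle_weight_gt0 e : (0 < cycle_weight e)%N.
Proof. by rewrite prodn_gt0 // => i; rewrite muln_gt0 expn_gt0 fact_gt0. Qed.

Lemma cycle_weight_sub e (i : 'I_N) : (0 < e i)%N ->
  cycle_weight e = (i.+1 * e i * cycle_weight (e - U_(i))%MM)%N.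
Proof.
move=> ei; rewrite /cycle_weight (bigD1 i) //= [in RHS](bigD1 i) //= mulnA.
congr (_ * _)%N; last first.
  by apply: eq_bigr => j ji; rewrite mnmBE mnm1E eq_sym (negPf ji) subn0.
rewrite mnmBE mnm1E eqxx; case: (e i) ei => // a _.
by rewrite subn1 /= expnS factS; nia.
Qed.

(** For D <= N this is the complete symmetric function h_D written in the power sums, the variable
    of index i standing for p_(i+1). *)
Definition cycle_index (D : nat) : {mpoly C[N]} :=
  \sum_(e : 'X_{1..N < D.+1} | mnmwgt e == D) (cycle_weight e)%:R^-1 *: 'X_[e].

Lemma leq_mdeg_mnmwgt e : (mdeg e <= mnmwgt e)%N.
Proof. by rewrite mdegE; apply: leq_sum => i _; rewrite leq_pmulr. Qed.

Lemma mcoeff_cycle_index D e :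
  (cycle_index D)@_e = if mnmwgt e == D then (cycle_weight e)%:R^-1 else 0.
Proof.
rewrite /cycle_index (mcoeff_bsum (P := fun e => mnmwgt e == D)
  (fun e => (cycle_weight e)%:R^-1)) // => {}e /eqP<-.
by rewrite ltnS leq_mdeg_mnmwgt.
Qed.

(** Newton's identity D h_D = sum_r p_r h_(D-r). On coefficients it splits the weight D of [e] as
    sum_i (i+1) e_i. *)
Lemma cycle_index_newton D :
  D%:R * cycle_index D = \sum_(i < N | (i < D)%N) 'X_i * cycle_index (D - i.+1).
Proof.
apply/mpolyP => e; rewrite mulr_natl mcoeffMn mcoeff_cycle_index raddf_sum /=.
rewrite (eq_bigr (fun i : 'I_N => if (0 < e i)%N && (mnmwgt e == D)
   then (i.+1 * e i)%:R * (cycle_weight e)%:R^-1 else 0)); last first.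
  move=> i iD; rewrite -['X_i]expr1 mcoeffXnM; case: (posnP (e i)) => // ei.
  have we : mnmwgt e = (mnmwgt (e - U_(i))%MM + i.+1)%N.
    rewrite -{1}(submK (m := U_(i)%MM) (m' := e)) ?mnmwgtD ?mnmwgt1 //.
    by apply/mnm_lepP => j; rewrite mnm1E; case: eqP => [<-|].
  rewrite mcoeff_cycle_index [(_ - _)%MM]/(e - U_(i))%MM we.
  rewrite -(eqn_add2r i.+1) subnK //; case: eqP => // _.
  rewrite (cycle_weight_sub ei); set a := (i.+1 * e i)%N.
  rewrite natrM invfM mulrA divff ?mul1r // pnatr_eq0 /a.
  by rewrite muln_eq0 -lt0n ei.
case: eqP => [eD|_]; last by rewrite mul0rn big1 // => i _; rewrite andbF.
transitivity ((mnmwgt e)%:R * (cycle_weight e)%:R^-1 : C); first by rewrite eD mulr_natl.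
rewrite {1}/mnmwgt natr_sum mulr_suml [RHS]big_mkcond.
apply: eq_bigr => i _; rewrite andbT mulnC; case: ifP => iD.
  by case: (posnP (e i)) => [->|//]; rewrite muln0 mul0r.
suff -> : e i = 0%N by rewrite muln0 mul0r.
have : (e i * i.+1 <= mnmwgt e)%N by rewrite /mnmwgt (bigD1 i) //= leq_addr.
by move: iD; rewrite eD; case: (e i) => // a; nia.
Qed.

Lemma cycle_index_parts D : (D <= N)%N ->
  cycle_index D = \sum_(nu : 'X_{1..N < D.+1} | is_part D nu)
     (zee nu)%:R^-1 *: 'X_[mult_mnm nu].
Proof.
move=> DN; apply/mpolyP => e; rewrite mcoeff_cycle_index raddf_sum /=.
have wD nu : is_part D nu -> mnmwgt (mult_mnm nu) = D.
  move=> nuP; have [/eqP<- _] := andP nuP; rewrite mdeg_mnmwgt // => i.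
  by rewrite (leq_trans (part_leq i nuP)).
case: eqP => [eD|neD]; last first.
  rewrite big1 // => nu nuP; rewrite mcoeffZ mcoeffX; case: eqP => [eq_e|]; last by rewrite mulr0.
  by case: neD; rewrite -eq_e wD.
have [nu nuP nu_e] := mult_mnm_surj DN eD.
have nu_lt : (mdeg nu < D.+1)%N by case/andP: nuP => /eqP->; rewrite ltnSn.
rewrite (bigD1 (BMultinom nu_lt)) //= mcoeffZ mcoeffX nu_e eqxx mulr1.
rewrite big1 ?addr0 => [|mu /andP[muP ne]].
  by rewrite (zeeE DN nuP) -nu_e.
rewrite mcoeffZ mcoeffX; case: eqP => [mu_e|]; last by rewrite mulr0.
by case/eqP: ne; apply: val_inj => /=; apply: mult_mnm_inj DN muP nuP _; rewrite mu_e nu_e.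
Qed.

End CycleIndex.

(** * The Cauchy identity for alpha = 1/m *)

Section CauchyKernel.
Variables (C : numFieldType) (m n N : nat).

(** Two alphabets: x_1, ..., x_n live in the coefficient ring [A], and y_1, ..., y_N are the
    variables over it. *)
Let A := {mpoly C[n]}.
Let scal : {rmorphism C -> {mpoly A[N]}} := (@mpolyC N A \o @mpolyC n C).

(** The k-th power sum of the alphabet in which each product x_i y_j occurs m times. *)
Let scaled_psum (k : nat) : {mpoly A[N]} := (m%:R * psum C n k) *: \sum_i 'X_i ^+ k.

Lemma scaled_psum_exp (nu : 'X_{1..N}) :
  (forall i, nu i <= N)%N ->
  \prod_(k < N) scaled_psum k.+1 ^+ mult_mnm nu k
  = (m%:R ^+ plength nu * \prod_(i < N | (0 < nu i)%N) psum C n (nu i)) *: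
    map_mpoly (@mpolyC n C) (ppow C nu).
Proof.
move=> le; rewrite -(prod_parts _ le) scaler_prod; congr (_ *: _).
  by rewrite big_split /= prodr_const /plength cardsE.
rewrite rmorph_prod; apply: eq_bigr => i _.
rewrite rmorph_sum; apply: eq_bigr => j _.
by rewrite rmorphXn /= map_mpolyX.
Qed.

Lemma mulser0 (a : 'X_{1..n}) : mulser C a 0 = 1.
Proof.
apply/mpolyP => c; rewrite mcoeff_prodser mcoeff1 mdeg_eq0; case: eqP => // ->.
by rewrite big1 // => i _; rewrite mnm0E /negbin bin0.
Qed.

Lemma mulser_newton (k : nat) :
  k%:R * mulser C [multinom m | i < n] k
  = \sum_(1 <= r < k.+1) (m%:R * psum C n r) * mulser C [multinom m | i < n] (k - r).
Proof.
rewrite /mulser (prodser_newton (t := fun=> m%:R)) => [|i a].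
  by apply: eq_bigr => r _; rewrite scaler_nat -mulrA mulr_natl.
rewrite mnmE -natrM negbin_rec natr_sum; apply: eq_bigr => r _.
by rewrite natrM.
Qed.

(** Both sides are the part of degree D in y of prod_(i,j) (1 - x_i y_j)^(-m): they satisfy the same
    Newton recursion from the initial value 1, and positive integers are invertible in [C]. *)
Lemma cycle_index_mulser D : (D <= N)%N ->
  mmap scal (fun i : 'I_N => scaled_psum i.+1) (cycle_index C N D)
  = prodser (fun=> mulser C [multinom m | i < n]) D.
Proof.
elim/ltn_ind: D => D IH DN.
case: D IH DN => [|D] IH DN.
  transitivity (1 : {mpoly A[N]}).
    rewrite -(rmorph1 (mmap scal (fun i : 'I_N => scaled_psum i.+1))); congr mmap.
    apply/mpolyP => e; rewrite mcoeff_cycle_index mcoeff1 -mdeg_eq0.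
    case: eqP => [we|]; last first.
      by case: eqP => // /eqP; rewrite mdeg_eq0 => /eqP->; rewrite mnmwgt0.
    have /eqP e0 : mdeg e == 0%N by rewrite -leqn0 -we leq_mdeg_mnmwgt.
    rewrite e0 eqxx; move/eqP: e0; rewrite mdeg_eq0 => /eqP->.
    by rewrite /cycle_weight big1 ?invr1 // => i _; rewrite mnm0E.
  apply/mpolyP => c; rewrite mcoeff_prodser mcoeff1 mdeg_eq0; case: eqP => // ->.
  by rewrite big1 // => i _; rewrite mnm0E mulser0.
have scal_inv : scal D.+1%:R^-1 * D.+1%:R = 1.
  by rewrite -(rmorph_nat scal) -rmorphM mulVf ?pnatr_eq0 // rmorph1.
rewrite -[LHS]mul1r -[RHS]mul1r -scal_inv -!mulrA; congr (_ * _).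
rewrite (prodser_newton (t := fun r => m%:R * psum C n r)); last first.
  by move=> _ a; rewrite mulser_newton.
rewrite -(rmorph_nat (mmap scal (fun i : 'I_N => scaled_psum i.+1))) -rmorphM.
rewrite cycle_index_newton rmorph_sum /= big_add1 /= big_mkord.
rewrite (big_ord_widen N (fun i => (m%:R * psum C n i.+1) *:
  ((\sum_(j < N) 'X_j ^+ i.+1) * prodser (fun=> mulser C [multinom m | i < n]) (D.+1 - i.+1)))) //.
apply: eq_bigr => i iD.
rewrite rmorphM /= mmapX mmap1U IH ?subSS ?ltnS ?leq_subr //; last exact: leq_trans (leq_subr _ _) (ltnW DN).
by rewrite /scaled_psum -scalerAl.
Qed.

(** Coefficient of y^kap in sum_nu z_nu^(-1) m^(l(nu)) p_nu(x) p_nu(y) = prod_(i,j) (1 - x_i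
    y_j)^(-m). *)
Lemma Cauchy_kernel_coef D (kap : 'X_{1..N}) : (D <= N)%N -> mdeg kap = D ->
  \sum_(nu : 'X_{1..N < D.+1} | is_part D nu)
     ((zee nu)%:R^-1 * m%:R ^+ plength nu * (ppow C nu)@_kap) *:
       \prod_(i < N | (0 < nu i)%N) psum C n (nu i)
  = \prod_i mulser C [multinom m | i < n] (kap i).
Proof.
move=> DN deg_kap.
transitivity ((prodser (fun=> mulser C [multinom m | i < n]) D)@_kap); last first.
  by rewrite mcoeff_prodser deg_kap eqxx.
rewrite -cycle_index_mulser // cycle_index_parts // [mmap _ _ _]raddf_sum raddf_sum.
apply: eq_bigr => nu nuP.
pose h (i : 'I_N) := scaled_psum i.+1.
rewrite -[X in _ = mcoeff _ X]/(mmap scal h ((zee nu)%:R^-1 *: 'X_[mult_mnm nu])) mmapZ mmapX.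
rewrite -[mmap1 _ _]/(\prod_(k < N) scaled_psum k.+1 ^+ mult_mnm nu k).
rewrite scaled_psum_exp => [|i]; last by rewrite (leq_trans (part_leq i nuP)).
rewrite /= mul_mpolyC !mcoeffZ mcoeff_map_mpoly /= -!mul_mpolyC.
rewrite !mpolyCM rmorphXn /= mpolyC_nat; ring.
Qed.

End CauchyKernel.

(** * Triangular linear algebra *)

Section Unitriangular.
Variables (F : fieldType) (s : nat) (w : 'I_s -> nat).

Definition wunitriangular (U : 'M[F]_s) :=
  (forall i, U i i = 1) /\ (forall i j, U i j != 0 -> j != i -> (w j < w i)%N).

(** Take an index of [S] of maximal weight among those where [v] is nonzero: any further term in the
    equation of its column would come from an index of [S] of larger weight. *)
Lemma wunitriangular_ker (U : 'M[F]_s) (S : pred 'I_s) (v : 'rV_s) :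
  wunitriangular U -> (forall i j, U i j != 0 -> S j -> S i) ->
  (forall j, S j -> (v *m U) 0 j = 0) -> forall i, S i -> v 0 i = 0.
Proof.
move=> [Ud Uw] SU vU i Si; apply: contraTeq isT => vi /=.
pose T i := S i && (v 0 i != 0).
have Ti : T i by rewrite /T Si.
case: (arg_maxnP w Ti) => j /andP[Sj vj] jmax.
have := vU j Sj; rewrite mxE (bigD1 j) //= Ud mulr1 big1 ?addr0 => [vj0|k kj].
  by rewrite vj0 eqxx in vj.
apply/eqP; rewrite mulf_eq0; case: eqP => //= /eqP vk; apply: contraT => Ukj.
have Tk : T k by rewrite /T (SU _ _ Ukj Sj).
have := Uw _ _ Ukj; rewrite eq_sym kj => /(_ isT); rewrite ltnNge.
by have := jmax k Tk; rewrite /= => ->.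
Qed.

Lemma wunitriangular_unit (U : 'M[F]_s) : wunitriangular U -> U \in unitmx.
Proof.
move=> Uw; rewrite -row_free_unit; apply: inj_row_free => v vU.
apply/rowP => i; rewrite [RHS]mxE.
by apply: (wunitriangular_ker (S := xpredT) Uw) => // j _; rewrite vU mxE.
Qed.

(** The vector q = v A^(-1) satisfies q (A B) = v B, so the vanishing of v B on [S] passes to q by
    triangularity of A B. *)
Lemma wunitriangular_solve (A B : 'M[F]_s) (S : pred 'I_s) (v : 'rV_s) :
  wunitriangular (A *m B) -> (forall i j, (A *m B) i j != 0 -> S j -> S i) ->
  (forall j, S j -> (v *m B) 0 j = 0) ->
  exists2 q, v = q *m A & forall i, S i -> q 0 i = 0.
Proof.
move=> ABw SAB vB; have /andP[Au _] : (A \in unitmx) && (B \in unitmx).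
  by rewrite -unitmx_mul wunitriangular_unit.
exists (v *m invmx A); first by rewrite mulmxKV.
by apply: (wunitriangular_ker ABw SAB) => j Sj; rewrite mulmxA mulmxKV // vB.
Qed.

End Unitriangular.

(** * The dominance order *)

Section Dominance.
Variable N : nat.
Implicit Types mu lam : 'X_{1..N}.

Definition partial_sum mu (k : nat) : nat := (\sum_(i < N | (i < k)%N) mu i)%N.
(** A numerical weight, strictly increasing along dominance, that serves in place of a linear
    extension of the order. *)
Definition dom_weight mu : nat := (\sum_(k < N.+1) partial_sum mu k)%N.

Lemma partial_sumS mu (i : 'I_N) : partial_sum mu i.+1 = (partial_sum mu i + mu i)%N.
Proof.
rewrite /partial_sum (bigD1 i) //= addnC; congr (_ + _)%N.
by apply: eq_bigl => j; rewrite -(inj_eq val_inj) /=; lia.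
Qed.

Lemma dominated_weight mu lam : dominated mu lam -> mu != lam ->
  (dom_weight mu < dom_weight lam)%N.
Proof.
move=> /forallP dom ne.
have le (k : 'I_N.+1) : (partial_sum mu k <= partial_sum lam k)%N by apply: dom.
rewrite ltn_neqAle leq_sum // andbT; apply: contraNneq ne => eq_w.
have eq_p (k : 'I_N.+1) : partial_sum mu k = partial_sum lam k.
  apply/eqP; rewrite eqn_leq le /=.
  move: eq_w; rewrite /dom_weight (bigD1 k) //= [in RHS](bigD1 k) //=.
  have : (\sum_(i < N.+1 | i != k) partial_sum mu i <= \sum_(i < N.+1 | i != k) partial_sum lam i)%N.
    exact: leq_sum.
  by move=> le_s e; rewrite -(leq_add2r (\sum_(i < N.+1 | i != k) partial_sum mu i)) e leq_add2l.
apply/eqP/mnmP => i.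
have := eq_p (Ordinal (ltn_ord (lift ord0 i))); rewrite /= partial_sumS partial_sumS.
have := eq_p (widen_ord (leqnSn N) i); rewrite /=; lia.
Qed.

(** Dominance compares the first parts, which are the largest. *)
Lemma dominated_gt D R mu lam : is_part D mu -> is_part D lam -> dominated mu lam ->
  [exists i, (R < mu i)%N] -> [exists i, (R < lam i)%N].
Proof.
move=> /andP[_ /forallP mu_mono] lamP /forallP dom /existsP[i mu_i].
have N_gt0 : (0 < N)%N by apply: leq_ltn_trans (ltn_ord i).
pose i0 := Ordinal N_gt0; apply/existsP; exists i0.
have first (nu : 'X_{1..N}) : partial_sum nu 1 = nu i0.
  by rewrite -[1%N]/(i0.+1) partial_sumS /partial_sum big1.
have := dom (Ordinal (N_gt0 : (1 < N.+1)%N)); rewrite -/(partial_sum mu _) -/(partial_sum lam _) /= !first.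
by apply: leq_trans; apply: leq_trans mu_i _; have /forallP/(_ i) := mu_mono i0.
Qed.

Lemma part_perm_eq D mu lam : is_part D mu -> is_part D lam -> perm_eq mu lam -> mu = lam.
Proof.
move=> muP lamP e; apply/val_inj/val_inj; apply: (sorted_eq (leT := geq)) => //.
- by move=> x y z yx xz; apply: leq_trans xz yx.
- by move=> x y /andP[yx xy]; apply/eqP; rewrite eqn_leq; apply/andP.
- exact: part_sorted muP.
- exact: part_sorted lamP.
Qed.

Lemma mcoeff_msymm (C : fieldType) lam c : (msymm C lam)@_c = (perm_eq c lam)%:R.
Proof.
rewrite /msymm (eq_bigr (fun e : 'X_{1..N < _} => 1 *: 'X_[e])) => [|e _]; last by rewrite scale1r.
rewrite (mcoeff_bsum (P := fun e : 'X_{1..N} => perm_eq e lam) (fun=> 1)) => [|e e_lam].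
  by case: ifP.
by rewrite /mdeg (perm_big _ e_lam).
Qed.

End Dominance.

(** * Orthogonality of (x_1...x_n)^R to the Jack polynomials having a part larger than R *)

Section JackOrthogonality.
Variables (C : numFieldType) (m n N D R : nat).
Hypotheses (m_gt0 : (0 < m)%N) (n_gt0 : (0 < n)%N).

Hypothesis n_le_N : (n <= N)%N.

Lemma spec_psum k : (0 < k)%N -> spec_vars n (psum C N k) = psum C n k.
Proof.
move=> k_gt0; rewrite /spec_vars rmorph_sum /=.
pose F (i : nat) : {mpoly C[n]} := oapp (fun j : 'I_n => 'X_j) 0 (insub i) ^+ k.
rewrite (eq_bigr (fun i : 'I_N => F i)) => [|i _]; last first.
  by rewrite rmorphXn /= /comp_mpoly mmapX mmap1U tnth_mktuple.
rewrite (bigID (fun i : 'I_N => (i < n)%N)) /= [X in _ + X]big1 ?addr0; last first.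
  by move=> i ni; rewrite /F insubN // expr0n gtn_eqF.
rewrite -(big_ord_widen N F n_le_N); apply: eq_bigr => j _.
by rewrite /F valK.
Qed.

Lemma spec_ppow (nu : 'X_{1..N}) :
  spec_vars n (ppow C nu) = \prod_(i < N | (0 < nu i)%N) psum C n (nu i).
Proof.
rewrite /spec_vars rmorph_prod; apply: eq_bigr => i nu_i.
exact: spec_psum.
Qed.

Lemma mcoeff_JackP_tri (Pl : {mpoly C[N]}) (u : 'X_{1..N} -> C) lam mu :
  Pl = msymm C lam +
         \sum_(mu : 'X_{1..N < D.+1} | is_part D mu && dominated mu lam && (mu != lam :> 'X_{1..N}))
            u mu *: msymm C mu ->
  is_part D lam -> is_part D mu ->
  Pl@_mu = (mu == lam)%:R + (if dominated mu lam && (mu != lam) then u mu else 0).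
Proof.
move=> -> lamP muP; rewrite mcoeffD mcoeff_msymm raddf_sum /=; congr (_ + _).
  congr (nat_of_bool _)%:R; apply/idP/eqP => [|->//]; exact: part_perm_eq muP lamP.
rewrite (eq_bigr (fun nu : 'X_{1..N < D.+1} => if mu == nu then u mu else 0)); last first.
  move=> nu /andP[/andP[nuP _] _]; rewrite mcoeffZ mcoeff_msymm; case: eqP => [->|ne].
    by rewrite perm_refl mulr1.
  by case: (boolP (perm_eq _ _)) => [/(part_perm_eq muP nuP)//|_]; rewrite mulr0.
have mu_lt : (mdeg mu < D.+1)%N by case/andP: muP => /eqP->; rewrite ltnSn.
case: ifP => [cond|/negP cond]; last first.
  rewrite big1 // => nu /andP[/andP[_ d] ne]; case: eqP => // e.
  by case: cond; rewrite e d ne.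
rewrite (bigD1 (BMultinom mu_lt)) /= ?muP ?cond // eqxx big1 ?addr0 // => nu /andP[_ ne].
by case: eqP => // e; case/eqP: ne; apply: val_inj.
Qed.

(* The element representing the functional
   [torus R \o spec_vars n] for the Jack scalar product has, by the Cauchy identity,
   y^kap-coefficient [torus R (\prod_i mulser (kap i))], which vanishes as soon as kap has
   a part larger than [R]; hence it is a combination of the [P kap] with all parts at most [R]. *)
Lemma torus_JackP (P : 'X_{1..N} -> {mpoly C[N]}) (lam : 'X_{1..N}) :
  is_JackP_family m%:R^-1 D P -> is_part D lam -> [exists i, (R < lam i)%N] ->
  torus m R (spec_vars n (P lam)) = 0.
Proof.
move=> [DN [P_tri [a [P_ppow P_orth]]]] lamP lam_gt.
pose I : pred 'X_{1..N < D.+1} := fun nu => is_part D nu.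
pose s := #|I|.
pose pt (i : 'I_s) : 'X_{1..N} := enum_val i.
have ptP i : is_part D (pt i) := enum_valP i.
have pt_inj : injective pt by move=> i j /val_inj/enum_val_inj.
pose L (nu : 'X_{1..N}) := torus m R (\prod_(i < N | (0 < nu i)%N) psum C n (nu i)).
(* [A] expands the P in power sums and [B] holds the coefficients of the power sums at partitions,
   so [A *m B] is the unitriangular matrix of the P. [v] holds the power-sum coordinates of the
   element representing [L]. *)
pose A : 'M[C]_s := \matrix_(i, j) a (pt i) (pt j).
pose B : 'M[C]_s := \matrix_(i, j) (ppow C (pt i))@_(pt j).
pose v : 'rV[C]_s := \row_j ((zee (pt j))%:R^-1 * m%:R ^+ plength (pt j) * L (pt j)).
have ABE i j : (A *m B) i j = (P (pt i))@_(pt j).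
  rewrite mxE P_ppow // raddf_sum (big_enum_val (A := I)) /=; apply: eq_bigr => k _.
  by rewrite !mxE mcoeffZ.
have ABu i : exists u : 'X_{1..N} -> C, forall j, (A *m B) i j =
    (j == i)%:R + (if dominated (pt j) (pt i) && (j != i) then u (pt j) else 0).
  have [u Pu] := P_tri _ (ptP i); exists u => j.
  by rewrite ABE (mcoeff_JackP_tri Pu) // !(inj_eq pt_inj).
have AB_dom i j : (A *m B) i j != 0 -> j != i -> dominated (pt j) (pt i).
  have [u ->] := ABu i => + /negPf ji; rewrite ji add0r andbT.
  by case: ifP => //; rewrite eqxx.
pose S i := [exists t, (R < pt i t)%N].
have AB_tri : wunitriangular (fun i => dom_weight (pt i)) (A *m B).
  split=> [i|i j nz ji]; first by have [u ->] := ABu i; rewrite eqxx andbF addr0.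
  by apply: dominated_weight (AB_dom _ _ nz ji) _; rewrite (inj_eq pt_inj).
have AB_S i j : (A *m B) i j != 0 -> S j -> S i.
  have [->//|ji] := eqVneq j i; move=> nz.
  exact: dominated_gt (ptP j) (ptP i) (AB_dom _ _ nz ji).
have vB j : S j -> (v *m B) 0 j = 0.
  move=> /existsP[t Rt].
  have deg_j : mdeg (pt j) = D by case/andP: (ptP j) => /eqP.
  have := Cauchy_kernel_coef C m n DN deg_j => /(congr1 (@torus C m n R)).
  (* The part of index [t] exceeds R, so the factor with this index alone makes the torus functional
     vanish. *)
  rewrite torus_sum (bigD1 t) //= torus_eq0 // => <-.
  rewrite mxE (big_enum_val (A := I)) /=; apply: eq_bigr => k _.
  by rewrite torusZ !mxE; ring.
(* [q] gives the representing element in the basis of the P. *)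
have [q vq q0] := wunitriangular_solve AB_tri AB_S vB.
pose Z (nu : 'X_{1..N}) : C := (zee nu)%:R * m%:R^-1 ^+ plength nu.
have LE j : L (pt j) = Z (pt j) * \sum_k q 0 k * a (pt k) (pt j).
  have <- : v 0 j = \sum_k q 0 k * a (pt k) (pt j).
    by rewrite vq mxE; apply: eq_bigr => k _; rewrite mxE.
  have z0 : (zee (pt j))%:R != 0 :> C.
    by rewrite (zeeE DN (ptP j)) pnatr_eq0 -lt0n cycle_weight_gt0.
  have m0 : m%:R ^+ plength (pt j) != 0 :> C by rewrite expf_neq0 // pnatr_eq0 -lt0n.
  by rewrite mxE /Z exprVn; field; rewrite z0.
rewrite P_ppow // /spec_vars raddf_sum /= torus_sum.
rewrite (eq_bigr (fun nu : 'X_{1..N < D.+1} => a lam nu * L nu)) => [|nu _]; last first.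
  by rewrite comp_mpolyZ torusZ -/(spec_vars n _) spec_ppow.
rewrite (big_enum_val (A := I)) /=.
(* The inner sum is the Jack scalar product of [P lam] and [P (pt k)], as [Z] is the squared norm of
   the power sums for alpha = 1/m. *)
transitivity (\sum_k q 0 k * \sum_j a lam (pt j) * a (pt k) (pt j) * Z (pt j)).
  rewrite (eq_bigr (fun j => \sum_k q 0 k * (a lam (pt j) * a (pt k) (pt j) * Z (pt j)))).
    by rewrite exchange_big; apply: eq_bigr => k _; rewrite mulr_sumr.
  move=> j _; rewrite [L _]LE !mulr_sumr; apply: eq_bigr => k _; ring.
rewrite big1 // => k _; have [Sk|Sk] := boolP (S k); first by rewrite q0 ?mul0r.
(* Where [q] may be nonzero, all parts are at most R, unlike those of [lam]. *)
have ne : lam != pt k by apply: contraNneq Sk => e; rewrite /S -e.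
have := P_orth lam (pt k) lamP (ptP k) ne; rewrite (big_enum_val (A := I)) /= => orth.
by rewrite [X in _ * X]orth mulr0.
Qed.

End JackOrthogonality.

(** * The rectangular partition (R^n) *)

Section Rectangle.
Variables (N n R : nat).
Hypothesis n_le_N : (n <= N)%N.
Implicit Types e mu : 'X_{1..N}.

Lemma rectE (i : 'I_N) : rect N n R i = if (i < n)%N then R else 0%N.
Proof. by rewrite mnmE. Qed.

Lemma big_rect (T : Type) (idx : T) (op : Monoid.com_law idx) (F : nat -> nat -> T) :
  (forall i, F i 0%N = idx) ->
  \big[op/idx]_(i < N) F i (rect N n R i) = \big[op/idx]_(i < n) F i R.
Proof.
move=> F0; rewrite (bigID (fun i : 'I_N => (i < n)%N)) /= [X in op _ X]big1 ?Monoid.mulm1.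
  rewrite (big_ord_widen N (fun i => F i R) n_le_N).
  by apply: eq_bigr => i lt; rewrite rectE lt.
by move=> i /negPf nlt; rewrite rectE nlt.
Qed.

Lemma mdeg_rect : mdeg (rect N n R) = (n * R)%N.
Proof.
by rewrite mdegE (@big_rect _ _ _ (fun _ a => a)) // sum_nat_const card_ord.
Qed.

Lemma rect_part : is_part (n * R) (rect N n R).
Proof.
rewrite /is_part mdeg_rect eqxx; apply/forallP => i; apply/forallP => j; apply/implyP => ij.
rewrite !rectE; case: (ltnP j n) => // jn.
by rewrite (leq_ltn_trans ij jn).
Qed.

Lemma rect_plength : (plength (rect N n R) <= n)%N.
Proof.
rewrite /plength -sum1_card (eq_bigl (fun i => (0 < rect N n R i)%N)); last by move=> i; rewrite inE.
rewrite big_mkcond (@big_rect _ _ _ (fun _ a => if (0 < a)%N then 1%N else 0%N)) //.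
apply: (@leq_trans (\sum_(i < n) 1)%N); last by rewrite sum1_card card_ord.
by apply: leq_sum => i _; case: ifP.
Qed.

(** The bounds put [e] below the rectangle componentwise, and the degrees agree. *)
Lemma rect_uniq e : mdeg e = (n * R)%N -> (forall i, e i <= R)%N ->
  (forall i : 'I_N, (n <= i)%N -> e i = 0%N) -> e = rect N n R.
Proof.
move=> deg_e le_R e0.
have le i : (e i <= rect N n R i)%N by rewrite rectE; case: ltnP => // /e0->.
have/mnm_lepP/submK <- : forall i, (e i <= rect N n R i)%N := le.
suff : mdeg (rect N n R - e)%MM == 0%N by rewrite mdeg_eq0 => /eqP->; rewrite add0m.
apply/eqP; have /(congr1 mdeg) := submK (introT mnm_lepP le : (e <= rect N n R)%MM).
by rewrite mdegD mdeg_rect deg_e; lia.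
Qed.

Lemma part_plength D mu (i : 'I_N) : is_part D mu -> (plength mu <= n)%N ->
  (n <= i)%N -> mu i = 0%N.
Proof.
move=> /andP[_ /forallP mono] len ni; apply/eqP; rewrite -leqn0 leqNgt; apply/negP => mu_i.
suff : (i.+1 <= plength mu)%N by move/leq_trans => /(_ _ len); rewrite ltnNge ni.
rewrite -[i.+1]card_ord -sum1_card (big_ord_widen N (fun=> 1%N)) ?sum1_card ?ltn_ord //.
apply/subset_leq_card/subsetP => j; rewrite !inE => ji.
have /forallP/(_ i)/implyP/(_ ji) := mono j.
exact: leq_trans.
Qed.

Lemma part_neq_rect mu : is_part (n * R) mu -> (plength mu <= n)%N ->
  mu != rect N n R -> [exists i, (R < mu i)%N].
Proof.
move=> muP len ne; apply: contraNT ne => /existsPn le; apply/eqP/rect_uniq.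
- by case/andP: muP => /eqP.
- by move=> i; rewrite leqNgt.
by move=> i; apply: part_plength muP len.
Qed.

Variable C : fieldType.

Lemma specX e : spec_vars n ('X_[e] : {mpoly C[N]}) =
  \prod_(i < N) oapp (fun j : 'I_n => 'X_j) 0 (insub (val i) : option 'I_n) ^+ e i.
Proof.
rewrite /spec_vars /comp_mpoly mmapX; apply: eq_bigr => i _.
by rewrite tnth_mktuple.
Qed.

(** Any other such exponent involves a variable of index at least n, which is set to 0. *)
Lemma specX_bounded e : mdeg e = (n * R)%N -> (forall i, e i <= R)%N ->
  spec_vars n ('X_[e] : {mpoly C[N]}) = if e == rect N n R then 'X_[[multinom R | i < n]] else 0.
Proof.
move=> deg_e le_R; rewrite specX; have [->|ne] := eqVneq.
  rewrite (@big_rect _ _ _ (fun i a => oapp (fun j : 'I_n => 'X_j) 0 (insub i : option 'I_n) ^+ a)) //.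
  rewrite mpolyXE_id; apply: eq_bigr => i _.
  by rewrite mnmE valK.
have [i /andP[ni ei]] : exists i : 'I_N, (n <= i)%N && (0 < e i)%N.
  apply/existsP; apply: contraNT ne => /existsPn h; apply/eqP/rect_uniq => // i ni.
  by have := h i; rewrite ni -eqn0Ngt => /eqP.
by rewrite (bigD1 i) //= insubN -?leqNgt // expr0n gtn_eqF // mul0r.
Qed.

Lemma spec_msymm_bounded mu : is_part (n * R) mu -> (forall i, mu i <= R)%N ->
  spec_vars n (msymm C mu) = if mu == rect N n R then 'X_[[multinom R | i < n]] else 0.
Proof.
move=> muP le_R; have deg_mu : mdeg mu = (n * R)%N by case/andP: muP => /eqP.
rewrite /spec_vars /msymm raddf_sum /=.
rewrite (eq_bigr (fun e : 'X_{1..N < _} =>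
   if (e : 'X_{1..N}) == rect N n R then 'X_[[multinom R | i < n]] else 0)); last first.
  move=> e e_mu; apply: specX_bounded; first by rewrite -deg_mu /mdeg (perm_big _ e_mu).
  move=> i; have : e i \in (mu : seq nat) by rewrite -(perm_mem e_mu) mnm_tnth mem_tnth.
  by case/tnthP => j ->; rewrite -mnm_tnth.
case: eqP => [mu_rect|ne]; last first.
  rewrite big1 // => e e_mu; case: eqP => // e_rect; case: ne.
  by apply: (part_perm_eq muP rect_part); rewrite -e_rect perm_sym.
rewrite (bigD1 (BMultinom (ltnSn (mdeg mu)))) /= ?perm_refl // mu_rect eqxx big1 ?addr0 // => e /andP[_ ne].
by case: eqP => // e_rect; case/eqP: ne; apply: val_inj => /=.
Qed.

(** Partitions dominated by (R^n) have all parts at most R, and among those only the rectangle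
    survives in n variables. *)
Lemma spec_JackP_rect alpha (P : 'X_{1..N} -> {mpoly C[N]}) :
  is_JackP_family alpha (n * R) P ->
  spec_vars n (P (rect N n R)) = 'X_[[multinom R | i < n]].
Proof.
move=> [_ [P_tri _]]; have [u ->] := P_tri _ rect_part.
have le i : (rect N n R i <= R)%N by rewrite rectE; case: ifP.
rewrite /spec_vars comp_mpolyD -/(spec_vars n (msymm C _)) spec_msymm_bounded ?rect_part //.
rewrite eqxx raddf_sum /= big1 ?addr0 // => mu /andP[/andP[muP dom] ne].
rewrite comp_mpolyZ -/(spec_vars n _) spec_msymm_bounded // ?(negPf ne) ?scaler0 // => i.
rewrite leqNgt; apply/negP => mu_i.
have : [exists j, (R < mu j)%N] by apply/existsP; exists i.
by move/(dominated_gt muP rect_part dom)/existsP => [j]; rewrite ltnNge le.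
Qed.

Lemma pconj_rect j : (0 < j)%N -> (j <= R)%N -> pconj (rect N n R) j = n.
Proof.
move=> j0 jR; rewrite /pconj -sum1_card.
rewrite (eq_bigl (fun i => (j <= rect N n R i)%N)); last by move=> i; rewrite inE.
rewrite big_mkcond (@big_rect _ _ _ (fun _ a => if (j <= a)%N then 1%N else 0%N)).
  by rewrite jR sum1_card card_ord.
by move=> _; rewrite leqNgt j0.
Qed.

(** Rows and columns are reversed on the right, so that the factor of index (i, j) belongs to the
    box with arm j and leg i. *)
Lemma prod_rect_boxes (F : nat -> nat -> nat -> nat -> C) :
  \prod_(i < N) \prod_(1 <= j < (rect N n R i).+1) F i j (rect N n R i) (pconj (rect N n R) j)
  = \prod_(i < n) \prod_(0 <= j < R) F (n.-1 - i)%N (R - j)%N R n.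
Proof.
rewrite (@big_rect _ _ _ (fun i a => \prod_(1 <= j < a.+1) F i j a (pconj (rect N n R) j))); last first.
  by move=> i; rewrite big_geq.
rewrite (reindex_inj rev_ord_inj) /=; apply: eq_bigr => i _.
rewrite big_add1 /= big_nat_rev /=; apply: eq_big_nat => j /andP[_ jR].
rewrite add0n subnSK // pconj_rect ?leq_subr ?subn_gt0 //.
by congr F; case: (n) i => [[]//|n' i] /=; rewrite subSS.
Qed.

End Rectangle.

(** For alpha = 1/m, the box with arm j and leg i contributes ((i+1)m + j)/m to c and (im + j + 1)/m
    to c'. *)
Lemma cfac_rect_ratio (C : numFieldType) m n R : (0 < m)%N ->
  cfac m%:R^-1 (rect (n * R + n) n R) / cfac' m%:R^-1 (rect (n * R + n) n R) =
  \prod_(1 <= i < n.+1) \prod_(1 <= j < R.+1)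
       (((i * m + j - 1)%N)%:R / (((i - 1) * m + j)%N)%:R) :> C.
Proof.
move=> m_gt0; have le := leq_addl (n * R) n; rewrite /cfac /cfac'.
rewrite (prod_rect_boxes R le (fun i j r p => m%:R^-1 * (r - j)%:R + p%:R - i.+1%:R + 1)).
rewrite (prod_rect_boxes R le (fun i j r p => m%:R^-1 * (r - j + 1)%:R + p%:R - i.+1%:R)).
rewrite -prodf_div big_add1 /= big_mkord; apply: eq_bigr => i _.
rewrite -prodf_div big_add1 /=; apply: eq_big_nat => j /andP[_ jR].
have m0 : m%:R != 0 :> C by rewrite pnatr_eq0 -lt0n.
have -> : (R - (R - j) = j)%N by lia.
have -> : (n.-1 - i).+1%:R = n%:R - i%:R :> C.
  by rewrite -natrB ?(ltnW (ltn_ord i)) //; congr _%:R; have := ltn_ord i; lia.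
have -> : (i.+1 * m + j.+1 - 1 = (i + 1) * m + j)%N by lia.
have -> : ((i.+1 - 1) * m + j.+1 = i * m + (j + 1))%N by rewrite subn1 addn1.
have -> : m%:R^-1 * j%:R + n%:R - (n%:R - i%:R) + 1 = ((i + 1) * m + j)%:R / m%:R :> C.
  by rewrite natrD natrM natrD; field.
have -> : m%:R^-1 * (j + 1)%:R + n%:R - (n%:R - i%:R) = (i * m + (j + 1))%:R / m%:R :> C.
  by rewrite !natrD natrM; field.
by rewrite invfM invrK mulrACA mulVf ?mulr1.
Qed.

(** The number nR + n of variables is large enough both to represent symmetric functions of degree
    nR faithfully and to specialize to n variables. *)
Theorem theorem4p3 (C : numClosedFieldType) (m n R : nat) (d : int -> C)
    (P : 'X_{1..n * R + n} -> {mpoly C[n * R + n]})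
    (gam : 'X_{1..n * R + n} -> C) :
  (0 < m)%N -> (0 < n)%N ->
  toeplitz_hdet m n d = toeplitz_hdet m n (truncF R d) ->
  (* P = the Jack P-functions of degree nR, parameter alpha = 1/m *)
  is_JackP_family (m%:R)^-1 (n * R) P ->
  (* gam = coefficients of the expansion of the degree-nR component of
     S_f(x_1..x_n;R) in the Jack Q-polynomials Q_mu(x_1..x_n), l(mu) <= n *)
  Sf_component n R d (n * R) =
    \sum_(mu : 'X_{1..(n * R + n) < (n * R).+1} | is_part (n * R) mu && (plength mu <= n)%N)
       gam mu *: spec_vars n (JackQ (m%:R)^-1 P mu) ->
  normalized_toeplitz_hdet m n d =
    gam (rect (n * R + n) n R) *
    \prod_(1 <= i < n.+1) \prod_(1 <= j < R.+1)
       (((i * m + j - 1)%N)%:R / (((i - 1) * m + j)%N)%:R).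
Proof.
move=> m_gt0 n_gt0 d_trunc Jack Sf_exp.
have le := leq_addl (n * R) n.
pose rct := rect (n * R + n) n R.
have rct_lt : (mdeg rct < (n * R).+1)%N by rewrite mdeg_rect.
rewrite -cfac_rect_ratio // /normalized_toeplitz_hdet d_trunc toeplitz_hdet_torus Sf_exp torus_sum.
rewrite (bigD1 (BMultinom rct_lt)) /=; last by rewrite rect_part // rect_plength.
(* Every other partition of nR with at most n parts has a part larger than R, so its term
   vanishes. *)
rewrite [X in _ + X]big1 ?addr0 => [|mu /andP[/andP[muP len] ne]]; last first.
  rewrite /JackQ /spec_vars comp_mpolyZ !torusZ (torus_JackP _ _ _ Jack) ?mulr0 //.
  by apply: (part_neq_rect le muP len); apply: contraNneq ne => e; apply/eqP/val_inj.
rewrite torusZ /JackQ /spec_vars comp_mpolyZ torusZ -/(spec_vars n _) (spec_JackP_rect _ Jack) //.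
(* The remaining torus value, at (x_1...x_n)^R, is up to n! the hyperdeterminant of the constant
   function 1, which cancels against the normalization. *)
rewrite [X in X / _](_ : _ = gam rct * (cfac m%:R^-1 rct / cfac' m%:R^-1 rct)
    * toeplitz_hdet m n (const_one_coef C)); first by rewrite mulfK // toeplitz_hdet_const_one_neq0.
by rewrite (toeplitz_hdet_const_one C m n R) !mulrA; ring.
Qed.
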